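(* In the cartesian monoidal category of sets, the open interval $(0,1)$ is a symmetric tricocycloid under the operations $$v\colon(0,1)^2\to(0,1)^2,\quad (r,s)\mapsto\Bigl(rs,\ \frac{r\,s^*}{(rs)^*}\Bigr),\qquad\qquad \gamma\colon(0,1)\to(0,1),\quad r\mapsto r^*,$$ where $r^*=1-r$ for $r\in(0,1)$. That is, $v$ is the structure map of a tricocycloid on $(0,1)$ and $\gamma$ is a symmetry for this tricocycloid.
   Context: A tricocycloid in a symmetric monoidal category $(\mathcal C,\otimes,I)$ (with $\otimes$ written as strictly associative and $\sigma$ the symmetry) is an object $H$ with an invertible map $v\colon H\otimes H\to H\otimes H$ satisfying $$(v\otimes1)(1\otimes\sigma)(v\otimes1)=(1\otimes v)(v\otimes1)(1\otimes v)\colon H\otimes H\otimes H\to H\otimes H\otimes H.$$ A symmetry for a tricocycloid $(H,v)$ is an involution $\gamma\colon H\to H$ (i.e. $\gamma^2=1$) satisfying $$(1\otimes\gamma)\,v\,(1\otimes\gamma)=v\,(\gamma\otimes1)\,v\colon H\otimes H\to H\otimes H.$$ A symmetric tricocycloid is a tricocycloid equipped with a symmetry. *)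

(* Defs.v *)
From mathcomp Require Import all_boot all_order all_algebra.
From mathcomp Require Import boolp reals.
From mathcomp Require Import ring lra.

Set Implicit Arguments.
Unset Strict Implicit.
Unset Printing Implicit Defensive.

Import Order.TTheory GRing.Theory Num.Theory.

Declare Scope cat_scope.
Delimit Scope cat_scope with cat.
Local Open Scope cat_scope.

Record category := Category {
  obj :> Type;
  hom : obj -> obj -> Type;
  idm : forall a, hom a a;
  comp : forall a b c, hom b c -> hom a b -> hom a c;
  comp1m : forall a b (f : hom a b), comp (idm b) f = f;
  compm1 : forall a b (f : hom a b), comp f (idm a) = f;
  compA : forall a b c d (h : hom c d) (g : hom b c) (f : hom a b),
    comp h (comp g f) = comp (comp h g) f }.

Arguments hom {_} _ _.
Arguments idm {_} _.
Arguments comp {_ _ _ _} _ _.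

(* g ∘ f is "f first, then g". *)
Notation "g ∘ f" := (comp g f) (at level 40, left associativity) : cat_scope.

Definition is_inverse (C : category) (a b : C) (f : hom a b) (g : hom b a) :=
  g ∘ f = idm a /\ f ∘ g = idm b.

Definition invertible (C : category) (a b : C) (f : hom a b) :=
  exists g, is_inverse f g.

Record smcat := SMCat {
  carrier :> category;
  unitob : carrier;
  tens : carrier -> carrier -> carrier;
  tensm : forall a b c d : carrier,
    hom a b -> hom c d -> hom (tens a c) (tens b d);
  assoc : forall a b c : carrier, hom (tens (tens a b) c) (tens a (tens b c));
  associ : forall a b c : carrier, hom (tens a (tens b c)) (tens (tens a b) c);
  lunit : forall a : carrier, hom (tens unitob a) a;
  luniti : forall a : carrier, hom a (tens unitob a);
  runit : forall a : carrier, hom (tens a unitob) a;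
  runiti : forall a : carrier, hom a (tens a unitob);
  swap : forall a b : carrier, hom (tens a b) (tens b a);

  tensm1 : forall a b : carrier, tensm (idm a) (idm b) = idm (tens a b);
  tensm_comp : forall (a b c a' b' c' : carrier)
      (g : hom b c) (f : hom a b) (g' : hom b' c') (f' : hom a' b'),
    tensm (g ∘ f) (g' ∘ f') = tensm g g' ∘ tensm f f';

  assocK : forall a b c : carrier, is_inverse (assoc a b c) (associ a b c);
  lunitK : forall a : carrier, is_inverse (lunit a) (luniti a);
  runitK : forall a : carrier, is_inverse (runit a) (runiti a);

  assoc_nat : forall (a b c a' b' c' : carrier)
      (f : hom a a') (g : hom b b') (h : hom c c'),
    assoc a' b' c' ∘ tensm (tensm f g) h = tensm f (tensm g h) ∘ assoc a b c;
  lunit_nat : forall (a b : carrier) (f : hom a b),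
    lunit b ∘ tensm (idm unitob) f = f ∘ lunit a;
  runit_nat : forall (a b : carrier) (f : hom a b),
    runit b ∘ tensm f (idm unitob) = f ∘ runit a;
  swap_nat : forall (a b a' b' : carrier) (f : hom a a') (g : hom b b'),
    swap a' b' ∘ tensm f g = tensm g f ∘ swap a b;

  pentagon : forall a b c d : carrier,
    assoc a b (tens c d) ∘ assoc (tens a b) c d
    = tensm (idm a) (assoc b c d) ∘ assoc a (tens b c) d
      ∘ tensm (assoc a b c) (idm d);
  triangle : forall a b : carrier,
    tensm (idm a) (lunit b) ∘ assoc a unitob b = tensm (runit a) (idm b);
  hexagon : forall a b c : carrier,
    assoc b c a ∘ swap a (tens b c) ∘ assoc a b c
    = tensm (idm b) (swap a c) ∘ assoc b a c ∘ tensm (swap a b) (idm c);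
  swapK : forall a b : carrier, swap b a ∘ swap a b = idm (tens a b) }.

Notation "a ⊗ b" := (tens a b) (at level 38, left associativity) : cat_scope.
Notation "f ⊗m g" := (tensm f g) (at level 38, left associativity) : cat_scope.

Section Tricocycloid.
Variables (C : smcat) (H : C).

(* The tensor product is not assumed strict: H ⊗ H ⊗ H is (H ⊗ H) ⊗ H, and a
   map acting on the last two factors is conjugated by the associator. *)
Definition on_first2 (f : hom (H ⊗ H) (H ⊗ H)) : hom (H ⊗ H ⊗ H) (H ⊗ H ⊗ H) :=
  f ⊗m idm H.

Definition on_last2 (f : hom (H ⊗ H) (H ⊗ H)) : hom (H ⊗ H ⊗ H) (H ⊗ H ⊗ H) :=
  associ H H H ∘ (idm H ⊗m f) ∘ assoc H H H.

Definition is_tricocycloid (v : hom (H ⊗ H) (H ⊗ H)) : Prop :=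
  invertible v /\
  on_first2 v ∘ on_last2 (swap H H) ∘ on_first2 v
  = on_last2 v ∘ on_first2 v ∘ on_last2 v.

Definition is_symmetry (v : hom (H ⊗ H) (H ⊗ H)) (γ : hom H H) : Prop :=
  γ ∘ γ = idm H /\
  (idm H ⊗m γ) ∘ v ∘ (idm H ⊗m γ) = v ∘ (γ ⊗m idm H) ∘ v.

Definition is_symmetric_tricocycloid (v : hom (H ⊗ H) (H ⊗ H)) (γ : hom H H) :=
  is_tricocycloid v /\ is_symmetry v γ.

End Tricocycloid.

Definition sets : category :=
  @Category Type (fun A B => A -> B) (fun _ x => x) (fun _ _ _ g f x => g (f x))
    (fun _ _ _ => erefl) (fun _ _ _ => erefl) (fun _ _ _ _ _ _ _ => erefl).

Definition cartesian_sets : smcat.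
Proof.
refine (@SMCat sets unit (fun A B : Type => (A * B)%type)
  (fun A B C D f g (p : A * C) => (f p.1, g p.2))
  (fun A B C (p : A * B * C) => (p.1.1, (p.1.2, p.2)))
  (fun A B C (p : A * (B * C)) => ((p.1, p.2.1), p.2.2))
  (fun A (p : unit * A) => p.2) (fun A (x : A) => (tt, x))
  (fun A (p : A * unit) => p.1) (fun A (x : A) => (x, tt))
  (fun A B (p : A * B) => (p.2, p.1))
  _ _ _ _ _ _ _ _ _ _ _ _ _) => //; rewrite /is_inverse /=.
- by move=> A B; apply: funext => -[].
- by move=> A B C; split; apply: funext; [case=> -[] | case=> ? []].
- by move=> A; split => //; apply: funext => -[[]].
- by move=> A; split => //; apply: funext => -[? []].
- by move=> A B; apply: funext => -[].
Defined.

Local Open Scope ring_scope.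

Section OpenUnitInterval.
Variable R : realType.

Definition ooI : Type := {r : R | 0 < r < 1}.
Implicit Types r s : ooI.

Lemma oo_star_subproof r : 0 < 1 - val r < 1.
Proof. by case: r => r /= /andP[r0 r1]; apply/andP; split; lra. Qed.

Definition oo_star r : ooI := exist _ (1 - val r) (oo_star_subproof r).

Lemma oo_mul_subproof r s : 0 < val r * val s < 1.
Proof.
case: r s => [r /= /andP[r0 r1]] [s /= /andP[s0 s1]].
by rewrite mulr_gt0 //= mulr_ilt1 // ltW.
Qed.

Definition oo_mul r s : ooI := exist _ (val r * val s) (oo_mul_subproof r s).

Lemma oo_ratio_subproof r s :
  0 < val r * val (oo_star s) / val (oo_star (oo_mul r s)) < 1.
Proof.
have /andP[p0 _] := valP (oo_star (oo_mul r s)).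
have /andP[q0 _] := valP (oo_mul r (oo_star s)).
rewrite divr_gt0 //= ltr_pdivrMr // mul1r.
by have /andP[_ r1] := valP r; rewrite /= in r1 *; lra.
Qed.

Definition oo_ratio r s : ooI :=
  exist _ (val r * val (oo_star s) / val (oo_star (oo_mul r s)))
    (oo_ratio_subproof r s).

Definition oo_v (p : ooI * ooI) : ooI * ooI :=
  (oo_mul p.1 p.2, oo_ratio p.1 p.2).

Definition oo_gamma (r : ooI) : ooI := oo_star r.

End OpenUnitInterval.

(* Main.v *)
Require Import Defs.
From mathcomp Require Import all_boot all_order all_algebra.
From mathcomp Require Import reals.
From mathcomp Require Import boolp ring lra.

Import Order.TTheory GRing.Theory Num.Theory.
Local Open Scope ring_scope.

(** Read r as the convex combination r x + r^* y. As r(s x + s^* y) + r^* z has weights rs, r s^*,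
    r^*, [oo_v] rebrackets ((x,y),z) as (x,(y,z)), while [oo_gamma] swaps two points. All weights
    being positive, bracketing and weights determine the parameters, so composites ending in the
    same bracketing with the same weights agree. This gives the inverse and both axioms; the lemmas
    check them in coordinates, as rational identities whose denominators are nonzero on the open
    interval. *)

Lemma oo_inv_fst_subproof {R : realType} (p q : ooI R) :
  0 < val p + val q * (1 - val p) < 1.
Proof.
case: p q => [p /= /andP[p0 p1]] [q /= /andP[q0 q1]].
by apply/andP; split; nra.
Qed.

(* [p + q p^*] is the complement of [p^* q^*]. It recovers [r] from
   [(p, q) = oo_v (r, s)] because [q p^* = r s^*] and [p = r s]. *)
Definition oo_inv_fst {R : realType} (p q : ooI R) : ooI R :=
  exist _ (val p + val q * (1 - val p)) (oo_inv_fst_subproof p q).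

Lemma oo_inv_snd_subproof {R : realType} (p q : ooI R) :
  0 < val p / val (oo_inv_fst p q) < 1.
Proof.
have /andP[d0 _] := valP (oo_inv_fst p q).
have /andP[p0 p1] := valP p; have /andP[q0 _] := valP q.
rewrite divr_gt0 //= ltr_pdivrMr // mul1r ltrDl mulr_gt0 // subr_gt0.
exact: p1.
Qed.

Definition oo_inv_snd {R : realType} (p q : ooI R) : ooI R :=
  exist _ (val p / val (oo_inv_fst p q)) (oo_inv_snd_subproof p q).

Definition oo_v_inv {R : realType} (p : ooI R * ooI R) : ooI R * ooI R :=
  (oo_inv_fst p.1 p.2, oo_inv_snd p.1 p.2).

Lemma oo_vK (R : realType) : cancel (@oo_v R) (@oo_v_inv R).
Proof.
move=> [[r hr] [s hs]]; congr pair; apply: val_inj => /=;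
  move: hr hs => /andP[r0 r1] /andP[s0 s1].
- by field; apply/eqP; nra.
- have rs_neq1 : 1 - r * s != 0 by apply/eqP; nra.
  (* Recovering r first leaves [field] the sole denominator r. *)
  have -> : r * s + r * (1 - s) / (1 - r * s) * (1 - r * s) = r by field.
  by field; apply/eqP; lra.
Qed.

Lemma oo_v_invK (R : realType) : cancel (@oo_v_inv R) (@oo_v R).
Proof.
move=> [[p hp] [q hq]]; congr pair; apply: val_inj => /=;
  move: hp hq => /andP[p0 p1] /andP[q0 q1];
  have r_neq0 : p + q * (1 - p) != 0 by apply/eqP; nra.
- by field.
- have -> : (p + q * (1 - p)) * (p / (p + q * (1 - p))) = p by field.
  by field; rewrite r_neq0 andbT; apply/eqP; lra.
Qed.

(** Both sides of the equation rebracket (((x,y),z),w), with weights rst, r s t^*, r s^*, r^*, as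
    (x,(y,(z,w))). *)
Lemma oo_v_tricocycloid (R : realType) :
  @is_tricocycloid cartesian_sets (ooI R) (@oo_v R).
Proof.
split.
  by exists (@oo_v_inv R); split; apply: funext => x; [exact: oo_vK|exact: oo_v_invK].
apply: funext => -[[[r hr] [s hs]] [t ht]].
congr (_, _, _); apply: val_inj => /=;
  move: hr hs ht => /andP[r0 r1] /andP[s0 s1] /andP[t0 t1].
- by rewrite mulrA.
all: have st_gt0 : 0 < s * t by exact: mulr_gt0.
all: have st_lt1 : s * t < 1 by nra.
all: have st_neq1 : 1 - s * t != 0 by apply/eqP; lra.
all: have rst_neq1 : 1 - r * (s * t) != 0 by apply/eqP; nra.
(* Once x is removed, the share of {y,z} times the share of y within {y,z} is the share of y. *)
- have -> : r * (1 - s * t) / (1 - r * (s * t)) * (s * (1 - t) / (1 - s * t)) =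
            r * s * (1 - t) / (1 - r * (s * t)) by field; rewrite rst_neq1.
  by rewrite mulrA.
- have rs_neq1 : 1 - r * s != 0 by apply/eqP; nra.
  have -> : r * (1 - s * t) / (1 - r * (s * t)) * (s * (1 - t) / (1 - s * t)) =
            r * s * (1 - t) / (1 - r * (s * t)) by field; rewrite rst_neq1.
  (* The complementary share, that of {z,w}; in this form the outer denominator is visibly
     nonzero. *)
  have -> : 1 - r * s * (1 - t) / (1 - r * (s * t)) =
            (1 - r * s) / (1 - r * (s * t)) by field.
  by field; rewrite rs_neq1 st_neq1 rst_neq1.
Qed.

(** Both sides of the second axiom carry ((x,y),z) to (y,(z,x)): one via ((y,x),z), the other via
    ((y,z),x). *)
Lemma oo_gamma_symmetry (R : realType) :
  @is_symmetry cartesian_sets (ooI R) (@oo_v R) (@oo_gamma R).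
Proof.
split; first by apply: funext => r; apply: val_inj => /=; ring.
apply: funext => -[[r hr] [s hs]].
congr pair; apply: val_inj => /=; move: hr hs => /andP[r0 r1] /andP[s0 s1];
  have rs_neq1 : 1 - r * s != 0 by apply/eqP; nra.
- by field.
- have -> : (1 - r * s) * (r * (1 - s) / (1 - r * s)) = r * (1 - s) by field.
  by field; rewrite rs_neq1 andbT; apply/eqP; nra.
Qed.

Theorem proposition28 (R : realType) :
  @is_symmetric_tricocycloid cartesian_sets (ooI R) (@oo_v R) (@oo_gamma R).
Proof.
split; [exact: oo_v_tricocycloid | exact: oo_gamma_symmetry].
Qed.
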